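(* Let $n,m,k\ge2$ be integers with $n\ge(m+1)k$ and $p=m+1$ prime. Then the generalized Kneser graph satisfies $$\chi(\mathrm{KN}(n,k,m))\ge\frac{\frac np-k}{p(p-1)}.$$
   Context: The generalized Kneser graph $\mathrm{KN}(n,k,m)$ has vertex set all ordered $m$-tuples $(A_1,\dots,A_m)$ of pairwise disjoint $k$-element subsets of $[n]$. Two vertices $\mathcal A=(A_1,\dots,A_m)$, $\mathcal B=(B_1,\dots,B_m)$ are adjacent iff either (A1) $\big(\bigcup_{\ell=1}^iA_\ell\big)\cap\big(\bigcup_{\ell=i}^mB_\ell\big)=\varnothing$ for all $i\in[m]$, or (A2) $\big(\bigcup_{\ell=1}^iB_\ell\big)\cap\big(\bigcup_{\ell=i}^mA_\ell\big)=\varnothing$ for all $i\in[m]$. *)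

(* Defs.v *)
From mathcomp Require Import all_boot all_order all_algebra.
Set Implicit Arguments. Unset Strict Implicit. Unset Printing Implicit Defensive.

(* Generalized Kneser graph KN(n,k,m).  Ground set [n] is 'I_n, the m blocks
   are indexed by 'I_m (block l+1 of the paper is index l here). *)

Definition kn_vertex_pred (n k m : nat) (A : {ffun 'I_m -> {set 'I_n}}) : bool :=
  [forall l, #|A l| == k] &&
  [forall l1, forall l2, (l1 != l2) ==> [disjoint A l1 & A l2]].

Definition KNvertex (n k m : nat) : finType :=
  {A : {ffun 'I_m -> {set 'I_n}} | kn_vertex_pred k A}.

Definition kn_A1 (n m : nat) (A B : {ffun 'I_m -> {set 'I_n}}) : bool :=
  [forall i : 'I_m,
    (\bigcup_(l : 'I_m | l <= i) A l) :&: (\bigcup_(l : 'I_m | i <= l) B l) == set0].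

Definition kn_adj (n k m : nat) (X Y : KNvertex n k m) : bool :=
  kn_A1 (val X) (val Y) || kn_A1 (val Y) (val X).

Definition colorable (V : finType) (e : rel V) (c : nat) : bool :=
  [exists f : {ffun V -> 'I_c}, forall x, forall y, e x y ==> (f x != f y)].

(* chromatic number: least c with a proper c-colouring.  For a loopless graph
   #|V| colours always suffice, so searching 0..#|V| is exhaustive. *)
Definition chromatic_number (V : finType) (e : rel V) : nat :=
  find (colorable e) (iota 0 #|V|.+1).

(* Main.v *)
From HB Require Import structures.
Require Import Defs.
From mathcomp Require Import all_boot all_order all_algebra.
From mathcomp Require Import zify ring.
Set Implicit Arguments. Unset Strict Implicit. Unset Printing Implicit Defensive.
Import Order.TTheory GRing.Theory Num.Theory.
Local Open Scope ring_scope.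

(** Let [p = m + 1] and let [t] colours suffice. Partial labellings of [[n]] by
    [Z_p] are the simplices of the [n]-fold join of [Z_p] with itself. Such a
    labelling [x] has classes [C_g], and a vertex whose blocks lie in
    [C_g, C_(g+1), ...] is seen at rotation [g]. Rank [x] by
    [sum_g (min(|C_g|, k) + #colours seen at rotation g)], which is monotone in
    [x] and at most [p (k + t)]. No colour is seen at two consecutive rotations,
    since any vertex inside [(C_1, ..., C_m)] is adjacent to any vertex inside
    [(C_2, ..., C_p)]. Hence, as [p] is prime, one can attach to [x] an equivariant sign in [Z_p]
    that is constant on chains of equal rank. This is an equivariant simplicial
    map from the subdivided [n]-fold join to the [p (k + t)]-fold join, and
    Dold's theorem gives [n <= p (k + t)].

    Dold's theorem is proved on chains: the periodic resolution of [Z_p] is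
    realised in the [n]-fold join by iterated cones and pushed to the target. If
    the target has fewer than [n] factors, the top term dies, and descending
    through the exactness of [tau - 1] and of the norm would make the
    augmentation of a vertex divisible by [p]. *)

(** * Integral chains on joins of copies of a cyclic group *)

Section Chains.

Variable q : nat.
Local Notation G := 'I_q.+2.

Local Notation simplex N := {ffun 'I_N -> option G}.
Local Notation chain N := {ffun simplex N -> int}.

Section Operators.

Variable N : nat.
Implicit Types (x y : simplex N) (e : 'I_N * G) (f : chain N).

(* The empty simplex is kept, so the chain complex below is augmented. *)
Definition void : simplex N := [ffun => None].

Definition add_vertex e x : simplex N := [ffun i => if i == e.1 then Some e.2 else x i].

Definition del_colour (j : 'I_N) x : simplex N := [ffun i => if i == j then None else x i].

Definition shift (a : G) x : simplex N := [ffun i => omap (+%R^~ a) (x i)].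

Definition face x y := [forall i, (x i != None) ==> (y i == x i)].

Definition nb_vertices x := #|[set i | x i != None]|.

(* Signs count the colours above [j], so that adding a new largest vertex
   in front of a simplex costs no sign. *)
Definition bdsign y (j : 'I_N) : int :=
  (-1) ^+ #|[set i : 'I_N | (j < i)%N && (y i != None)]|.

(** Chains are coefficient functions, so the value at [y] collects the coefficients of the simplices
    that have [y] as a facet. *)
Definition bd f : chain N :=
  [ffun y : simplex N => \sum_(e : 'I_N * G | y e.1 == None) bdsign y e.1 * f (add_vertex e y)].

Definition cone e f : chain N :=
  [ffun y : simplex N => if y e.1 == Some e.2 then f (del_colour e.1 y) else 0].

Definition tau (a : G) f : chain N := [ffun x : simplex N => f (shift (- a) x)].

Definition delta x : chain N := [ffun y : simplex N => (x == y)%:R].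

Definition supported (P : pred (simplex N)) f := forall y, f y != 0 -> P y.

Lemma faceP x y :
  reflect (forall i g, x i = Some g -> y i = Some g) (face x y).
Proof.
apply: (iffP forallP) => [H i g xi|H i].
  by have := H i; rewrite xi => /eqP.
by case xi: (x i) => [g|] //=; rewrite (H _ _ xi).
Qed.

Lemma face_refl x : face x x.
Proof. exact/faceP. Qed.

Lemma face_trans : transitive face.
Proof.
by move=> y x z /faceP xy /faceP yz; apply/faceP => i g /xy /yz.
Qed.

Lemma voidP x : reflect (forall i, x i = None) (x == void).
Proof.
apply: (iffP eqP) => [-> i|H]; first by rewrite ffunE.
by apply/ffunP => i; rewrite ffunE H.
Qed.

Lemma bdsign_add e y j : y e.1 = None ->
  bdsign (add_vertex e y) j = if (j < e.1)%N then - bdsign y j else bdsign y j.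
Proof.
move=> ye; rewrite /bdsign; case: ifPn => lt_je.
  have -> : [set i : 'I_N | (j < i)%N && (add_vertex e y i != None)]
            = e.1 |: [set i : 'I_N | (j < i)%N && (y i != None)].
    by apply/setP => i; rewrite !inE ffunE; case: (eqVneq i e.1) => [->|_] //=; rewrite lt_je.
  by rewrite cardsU1 !inE ye eqxx andbF /= exprS mulN1r.
congr (_ ^+ #|pred_of_set _|); apply/setP => i; rewrite !inE ffunE.
by case: (eqVneq i e.1) => [->|_] //=; rewrite (negPf lt_je).
Qed.

Lemma add_comm e e' y : e.1 != e'.1 ->
  add_vertex e (add_vertex e' y) = add_vertex e' (add_vertex e y).
Proof.
move=> ne; apply/ffunP => i; rewrite !ffunE.
by case: (eqVneq i e.1) => [->|//]; rewrite (negPf ne).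
Qed.

Lemma bd_is_zmod_morphism : zmod_morphism bd.
Proof.
move=> f g; apply/ffunP => y; rewrite !ffunE -sumrB.
by apply: eq_bigr => e _; rewrite !ffunE mulrBr.
Qed.
HB.instance Definition _ := GRing.isZmodMorphism.Build _ _ bd bd_is_zmod_morphism.

Lemma cone_is_zmod_morphism e : zmod_morphism (cone e).
Proof.
by move=> f g; apply/ffunP => y; rewrite !ffunE; case: ifP; rewrite ?subrr // !ffunE.
Qed.
HB.instance Definition _ e :=
  GRing.isZmodMorphism.Build _ _ (cone e) (cone_is_zmod_morphism e).

Lemma tau_is_zmod_morphism a : zmod_morphism (tau a).
Proof. by move=> f g; apply/ffunP => y; rewrite !ffunE. Qed.
HB.instance Definition _ a :=
  GRing.isZmodMorphism.Build _ _ (tau a) (tau_is_zmod_morphism a).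

(** Adding two vertices in either order gives the same simplex with opposite signs, so swapping them
    negates the double sum. *)
Lemma bd_bd f : bd (bd f) = 0.
Proof.
apply/ffunP => y; rewrite !ffunE.
pose P (u : ('I_N * G) * ('I_N * G)) :=
  [&& y u.1.1 == None, y u.2.1 == None & u.1.1 != u.2.1].
pose T (u : ('I_N * G) * ('I_N * G)) :=
  bdsign y u.1.1 * (bdsign (add_vertex u.1 y) u.2.1 * f (add_vertex u.2 (add_vertex u.1 y))).
have -> : \sum_(e : 'I_N * G | y e.1 == None) bdsign y e.1 * bd f (add_vertex e y)
          = \sum_(u | P u) T u.
  under eq_bigr => e _ do rewrite ffunE mulr_sumr.
  rewrite pair_big_dep; apply: eq_bigl => u; rewrite /P !ffunE /= eq_sym.
  by case: (eqVneq u.1.1 u.2.1) => [->|_]; rewrite ?andbF ?andbT.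
set S := \sum_(u | P u) T u.
suff: S = - S by move/eqP; rewrite -addr_eq0 -mulr2n mulrn_eq0 => /eqP.
rewrite /S -sumrN (reindex_inj (h := fun u => (u.2, u.1))) /=; last by move=> [? ?] [? ?] [-> ->].
apply: eq_big => [u|u]; first by rewrite /P /= [u.2.1 == _]eq_sym andbCA.
rewrite /P /T /= => /and3P[/eqP y1 /eqP y2 ne].
rewrite (add_comm y (e := u.1)) 1?eq_sym // !bdsign_add //.
case: (ltngtP u.1.1 u.2.1) ne => [||/val_inj ->]; rewrite ?eqxx // => _ _; ring.
Qed.

Lemma add_del e y : y e.1 = Some e.2 -> add_vertex e (del_colour e.1 y) = y.
Proof.
by move=> ye; apply/ffunP => i; rewrite !ffunE; case: (eqVneq i e.1) => [->|].
Qed.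

Lemma del_add e y : y e.1 = None -> del_colour e.1 (add_vertex e y) = y.
Proof.
by move=> ye; apply/ffunP => i; rewrite !ffunE; case: (eqVneq i e.1) => [->|].
Qed.

Definition below e y :=
  [forall i : 'I_N, (y i != None) ==> (i < e.1)%N || (i == e.1) && (y i == Some e.2)].

Lemma bdsign_below e y : below e y -> bdsign y e.1 = 1.
Proof.
move=> /forallP H; rewrite /bdsign (_ : [set i | _] = set0) ?cards0 //.
apply/setP => i; rewrite !inE; apply/negbTE; rewrite negb_and orbC -implybE.
have := H i; case: (y i != None) => //= /orP[|/andP[/eqP -> _]]; last by rewrite ltnn.
by move=> lt; rewrite -leqNgt ltnW.
Qed.

(** Coning kills the simplices that already contain [e]; on the right they cancel against the terms
    of [cone e (bd f)] that delete [e] and restore it. No colour exceeds [e.1], so these terms carry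
    sign 1. *)
Lemma bd_cone e f : supported (below e) f -> bd (cone e f) = f - cone e (bd f).
Proof.
move=> Sf; apply/ffunP => y; rewrite !ffunE.
have fE (b : int) : (below e y -> b = 1) -> b * f y = f y.
  by move=> H; case: (eqVneq (f y) 0) => [->|/Sf/H ->]; rewrite ?mulr0 ?mul1r.
case: (eqVneq (y e.1) (Some e.2)) => [ye|ne]; last first.
  rewrite subr0; case ye: (y e.1) => [s|].
    rewrite big1 => [|e' /eqP ye']; last first.
      rewrite !ffunE; case: (eqVneq e.1 e'.1) => [E|_]; first by rewrite E ye' in ye.
      by rewrite (negPf ne) mulr0.
    case: (eqVneq (f y) 0) => [->//|/Sf/forallP/(_ e.1)].
    by rewrite eqxx ltnn (negPf ne) ye.
  rewrite (bigD1 e) ?ye //= big1 ?addr0 => [|e' /andP[ye' ne']]; last first.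
    rewrite !ffunE; case: (eqVneq e.1 e'.1) => [E|_]; last by rewrite ye mulr0.
    case: eqP => [[E']|_]; last by rewrite mulr0.
    by rewrite (surjective_pairing e) (surjective_pairing e') E E' eqxx in ne'.
  by rewrite ffunE !ffunE eqxx eqxx del_add //; apply: fE => /bdsign_below.
have dN : del_colour e.1 y e.1 = None by rewrite ffunE eqxx.
rewrite [in RHS](bigD1 e) /= ?dN // add_del // opprD addrA.
have bE : below e y -> bdsign (del_colour e.1 y) e.1 = 1.
  move=> b; rewrite -(bdsign_below b) -{2}(add_del ye) bdsign_add ?ltnn //.
rewrite (fE _ bE) subrr sub0r -sumrN [in RHS]big_mkcond [in LHS]big_mkcond /=.
apply: eq_bigr => e' _; rewrite ffunE.
case: (eqVneq e'.1 e.1) => [E|ne1].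
  rewrite E ye /=; case: ifP => // /andP[_ ne'].
  rewrite (_ : f _ = 0) ?mulr0 ?oppr0 //; apply/eqP; apply: contraR ne'.
  move/Sf/forallP/(_ e.1); rewrite !ffunE E eqxx ltnn /= => /eqP[E'].
  by rewrite (surjective_pairing e) (surjective_pairing e') E E' eqxx.
have -> : e' != e by apply: contra ne1 => /eqP ->.
have -> : del_colour e.1 y e'.1 = y e'.1 by rewrite ffunE (negPf ne1).
rewrite andbT; case: ifP => // /eqP ye'.
have -> : add_vertex e' y e.1 = y e.1 by rewrite ffunE eq_sym (negPf ne1).
rewrite ye eqxx.
have -> : del_colour e.1 (add_vertex e' y) = add_vertex e' (del_colour e.1 y).
  apply/ffunP => i; rewrite !ffunE.
  by case: (eqVneq i e.1) => [->|//]; rewrite eq_sym (negPf ne1).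
case: (eqVneq (f (add_vertex e' (del_colour e.1 y))) 0) => [->|]; first by rewrite !mulr0 oppr0.
move/Sf/forallP/(_ e'.1); rewrite ffunE eqxx /= (negPf ne1) orbF => lt.
by rewrite -{1}(add_del ye) bdsign_add // lt mulNr.
Qed.

Lemma tauE a f y : tau a f y = f (shift (- a) y).
Proof. by rewrite ffunE. Qed.

Lemma coneE e f y :
  cone e f y = if y e.1 == Some e.2 then f (del_colour e.1 y) else 0.
Proof. by rewrite ffunE. Qed.

Lemma shiftD a b x : shift a (shift b x) = shift (a + b) x.
Proof.
by apply/ffunP => i; rewrite !ffunE; case: (x i) => //= g; rewrite -addrA (addrC b).
Qed.

Lemma shift0 x : shift 0 x = x.
Proof. by apply/ffunP => i; rewrite !ffunE; case: (x i) => //= g; rewrite addr0. Qed.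

Lemma shiftK a : cancel (shift a) (shift (- a)).
Proof. by move=> x; rewrite shiftD addNr shift0. Qed.

Lemma shiftNK a : cancel (shift (- a)) (shift a).
Proof. by move=> x; rewrite shiftD addrN shift0. Qed.

Lemma shift_eqNone a x i : (shift a x i == None) = (x i == None).
Proof. by rewrite ffunE; case: (x i). Qed.

Lemma shift_eqSome a x i g : (shift a x i == Some g) = (x i == Some (g - a)).
Proof.
rewrite ffunE; case: (x i) => //= h.
by apply/eqP/eqP => [[<-]|[->]]; rewrite ?addrK ?subrK.
Qed.

Lemma shift_void a : shift a void = void.
Proof. by apply/ffunP => i; rewrite !ffunE. Qed.

Lemma shift_add a e x : shift a (add_vertex e x) = add_vertex (e.1, e.2 + a) (shift a x).
Proof. by apply/ffunP => i; rewrite !ffunE /=; case: eqP. Qed.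

Lemma shift_del a j x : shift a (del_colour j x) = del_colour j (shift a x).
Proof. by apply/ffunP => i; rewrite !ffunE /=; case: eqP. Qed.

Lemma bdsign_shift a x j : bdsign (shift a x) j = bdsign x j.
Proof.
by congr (_ ^+ #|pred_of_set _|); apply/setP => i; rewrite !inE shift_eqNone.
Qed.

Lemma tau_bd a f : tau a (bd f) = bd (tau a f).
Proof.
apply/ffunP => y; rewrite !ffunE.
rewrite (reindex_inj (h := fun e : 'I_N * G => (e.1, e.2 - a))) /=; last first.
  by apply: (can_inj (g := fun e => (e.1, e.2 + a))) => -[i g] /=; rewrite subrK.
apply: eq_big => [e|e _]; first by rewrite shift_eqNone.
by rewrite ffunE bdsign_shift shift_add.
Qed.

Lemma tau_cone a e f : tau a (cone e f) = cone (e.1, e.2 + a) (tau a f).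
Proof.
by apply/ffunP => y; rewrite tauE !coneE tauE shift_eqSome opprK shift_del.
Qed.

Lemma tauD a b f : tau a (tau b f) = tau (a + b) f.
Proof. by apply/ffunP => y; rewrite !ffunE shiftD opprD addrC. Qed.

Lemma tau_delta a x : tau a (delta x) = delta (shift a x).
Proof. by apply/ffunP => y; rewrite !ffunE (can2_eq (shiftK a) (shiftNK a)). Qed.

Definition Nm f : chain N := \sum_a tau a f.

(* The two differentials of the periodic resolution of the cyclic group. *)
Definition dper (b : bool) f : chain N := if b then tau 1 f - f else Nm f.

Lemma NmE f y : Nm f y = \sum_a f (shift (- a) y).
Proof. by rewrite /Nm sum_ffunE; apply: eq_bigr => a _; rewrite ffunE. Qed.

Lemma dper_is_zmod_morphism b : zmod_morphism (dper b).
Proof.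
move=> f g; case: b => /=.
  by rewrite /dper raddfB /= !opprD !opprK addrACA.
by rewrite /dper /Nm -sumrB; apply: eq_bigr => a _; rewrite raddfB.
Qed.
HB.instance Definition _ b :=
  GRing.isZmodMorphism.Build _ _ (dper b) (dper_is_zmod_morphism b).

Lemma tau_Nm a f : tau a (Nm f) = Nm f.
Proof.
rewrite /Nm raddf_sum /= [RHS](reindex_inj (addrI a)).
by apply: eq_bigr => b _; rewrite tauD.
Qed.

Lemma dper_dper b f : dper b (dper (~~ b) f) = 0.
Proof.
case: b => /=; first by rewrite /dper tau_Nm subrr.
rewrite /Nm (eq_bigr (fun a => tau (a + 1) f - tau a f)) => [|a _]; last by rewrite raddfB /= tauD.
by rewrite sumrB [X in _ - X](reindex_inj (addIr 1)) subrr.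
Qed.

Lemma bd_dper b f : bd (dper b f) = dper b (bd f).
Proof.
case: b; first by rewrite /dper raddfB /= tau_bd.
by rewrite /dper /Nm raddf_sum; apply: eq_bigr => a _; rewrite tau_bd.
Qed.

(** The picked colour depends only on the support of [x], which shifts preserve; this makes the
    label equivariant off [void]. *)
Definition lead x : G :=
  if [pick i | x i != None] is Some i then odflt 0 (x i) else 0.

Lemma lead_shift a x : x != void -> lead (shift a x) = lead x + a.
Proof.
move=> nv; rewrite /lead.
rewrite (eq_pick (Q := fun i => x i != None)) => [|i]; last by rewrite shift_eqNone.
case: pickP => [i|H].
  by rewrite ffunE; case: (x i).
by case/voidP: nv => i; have /negbFE/eqP := H i.
Qed.

(* The nonempty simplices form a free orbit space with fundamental domain
   [lead y = 0], hence both kernels are images away from [void]. *)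
Lemma dper_exact b f : dper b f = 0 ->
  exists g, forall y, y != void -> f y = dper (~~ b) g y.
Proof.
case: b => /= [/eqP|] E.
  have inv a : tau a f = f.
    rewrite -[a]natr_Zp; elim: (val a) => [|k IH].
      by apply/ffunP => y; rewrite ffunE oppr0 shift0.
    by rewrite -natr1 addrC -tauD IH; apply/eqP; rewrite -subr_eq0.
  (* Keep one point of each orbit; the norm then rebuilds the invariant chain [f]. *)
  exists [ffun y : simplex N => if lead y == 0 then f y else 0] => y nv.
  rewrite /dper NmE (bigD1 (lead y)) //= big1 => [|a ne].
    by rewrite ffunE lead_shift // subrr eqxx addr0 -{1}(inv (lead y)) ffunE.
  by rewrite ffunE lead_shift // subr_eq0 eq_sym (negPf ne).
(* A discrete antiderivative: minus the sum of [f] over the members of the orbit of [y] with lead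
   from 1 to [lead y]. *)
exists [ffun y : simplex N =>
  - \sum_(t : G | (0 < t <= lead y)%N) f (shift (t - lead y) y)] => y nv.
rewrite !ffunE lead_shift // opprK.
under eq_bigr => t _ do rewrite shiftD -addrA -opprD subrK.
set s := lead y; pose h (t : G) := f (shift (t - s) y).
have fE : f y = h s by rewrite /h subrr shift0.
rewrite -/s [X in - X + _](eq_bigr h) // [X in _ + X](eq_bigr h) // fE.
(* At lead 0 the orbit wraps around, and the antiderivative closes up because the norm of [f]
   vanishes. *)
case: (eqVneq s 0) => [s0|ns].
  rewrite [X in _ + X]big_pred0 ?addr0 => [|t]; last by rewrite s0 lt0n leqn0 andNb.
  have: \sum_t h t = 0.
    move/ffunP/(_ y): E; rewrite /dper NmE ffunE => E0.
    rewrite -[RHS]E0 [RHS](reindex_inj (h := fun t => s - t)) /=; last first.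
      by move=> t t' /addrI /oppr_inj.
    by apply: eq_bigr => t _; rewrite opprB.
  rewrite (bigD1 0) //= -s0 => /eqP; rewrite addr_eq0 => /eqP ->.
  congr (- _); apply: eq_bigl => t.
  rewrite s0 /= add0n modn_mod (modn_small (isT : 1 < q.+2)%N) subn1 modn_small //.
  by rewrite lt0n -[X in _ && X]ltnS (ltn_ord t) andbT.
have s_gt0 : (0 < s)%N by rewrite lt0n.
have vs : val (s - 1) = (val s).-1.
  have -> : s - 1 = (val s).-1%:R.
    by apply/eqP; rewrite subr_eq natr1 prednK // natr_Zp.
  by rewrite Zp_nat /= modn_small // (leq_ltn_trans (leq_pred _)).
rewrite [X in _ = - _ + X](bigD1 s) ?s_gt0 ?leqnn // addrCA.
rewrite [X in - X](eq_bigl (fun t : G => (0 < t <= s)%N && (t != s))) ?addNr ?addr0 // => t.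
by rewrite vs -[t == s]/(val t == val s); move: s_gt0; rewrite /=; lia.
Qed.

End Operators.

Arguments void {N}.

Lemma bd_void N : bd (delta void) = 0 :> chain N.
Proof.
apply/ffunP => y; rewrite !ffunE big1 // => e _; rewrite ffunE.
case: eqP => [/ffunP/(_ e.1)|]; last by rewrite mulr0.
by rewrite !ffunE eqxx.
Qed.

(** * Linear extension of maps from simplices to chains *)

Section Extension.

Variables n N : nat.
Implicit Types (F : simplex n -> chain N) (f : chain n).

Definition ext F f : chain N := [ffun y : simplex N => \sum_x f x * F x y].

Lemma ext_is_zmod_morphism F : zmod_morphism (ext F).
Proof.
move=> f g; apply/ffunP => y; rewrite !ffunE -sumrB.
by apply: eq_bigr => x _; rewrite !ffunE mulrBl.
Qed.
HB.instance Definition _ F :=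
  GRing.isZmodMorphism.Build _ _ (ext F) (ext_is_zmod_morphism F).

Lemma eq_ext F F' f : F =1 F' -> ext F f = ext F' f.
Proof. by move=> E; apply/ffunP => y; rewrite !ffunE; apply: eq_bigr => x _; rewrite E. Qed.

Lemma ext_delta F x : ext F (delta x) = F x.
Proof.
apply/ffunP => y; rewrite ffunE (bigD1 x) //= ffunE eqxx mul1r big1 ?addr0 // => z ne.
by rewrite ffunE eq_sym (negPf ne) mul0r.
Qed.

Lemma bd_ext F f : bd (ext F f) = ext (fun x => bd (F x)) f.
Proof.
apply/ffunP => y; rewrite !ffunE.
under eq_bigr => e _ do rewrite ffunE mulr_sumr.
rewrite exchange_big; apply: eq_bigr => x _; rewrite ffunE mulr_sumr.
by apply: eq_bigr => e _; rewrite mulrCA.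
Qed.

Lemma tau_ext a F f : tau a (ext F f) = ext (fun x => tau a (F x)) f.
Proof. by apply/ffunP => y; rewrite !ffunE; apply: eq_bigr => x _; rewrite ffunE. Qed.

Lemma ext_tau a F f : ext (fun x => F (shift a x)) f = ext F (tau a f).
Proof.
apply/ffunP => y; rewrite !ffunE [RHS](reindex_inj (can_inj (shiftK a))).
by apply: eq_bigr => x _; rewrite tauE shiftK.
Qed.

Lemma bd_sum_delta f x : bd f x = \sum_z f z * bd (delta z) x.
Proof.
rewrite ffunE.
under [RHS]eq_bigr => z _ do rewrite ffunE mulr_sumr.
rewrite exchange_big /=; apply: eq_bigr => e _; rewrite (bigD1 (add_vertex e x)) //=.
rewrite ffunE eqxx mulr1 mulrC big1 ?addr0 // => z ne.
by rewrite ffunE (negPf ne) !mulr0.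
Qed.

Lemma ext_bd F f : ext F (bd f) = ext (fun z => ext F (bd (delta z))) f.
Proof.
apply/ffunP => y; rewrite !ffunE.
under eq_bigr => x _ do rewrite bd_sum_delta mulr_suml.
rewrite exchange_big; apply: eq_bigr => z _ /=; rewrite ffunE mulr_sumr.
by apply: eq_bigr => x _; rewrite mulrA.
Qed.

Lemma ext_neq0 F f y : ext F f y != 0 -> exists2 x, f x != 0 & F x y != 0.
Proof.
rewrite ffunE => nz.
have [x nx|H] := pickP (fun x => f x * F x y != 0).
  by move: nx; rewrite mulf_eq0 negb_or => /andP[]; exists x.
by rewrite big1 ?eqxx // in nz => x _; have /negbFE/eqP := H x.
Qed.

Lemma bd_delta_neq0 (x y : simplex n) :
  bd (delta x) y != 0 -> face y x /\ x != void.
Proof.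
rewrite ffunE => nz.
have [e /andP[/eqP ye /eqP xE]|H] :=
  pickP (fun e : 'I_n * G => (y e.1 == None) && (x == add_vertex e y)).
  split.
    apply/faceP => i g yi; rewrite xE ffunE; case: eqP => // E.
    by rewrite E ye in yi.
  by apply/negP => /voidP/(_ e.1); rewrite xE ffunE eqxx.
rewrite big1 ?eqxx // in nz => e ye.
by have := H e; rewrite ye /= ffunE => ->; rewrite mulr0.
Qed.

Lemma ext_dper b F f : (forall a x, tau a (F x) = F (shift a x)) ->
  ext F (dper b f) = dper b (ext F f).
Proof.
move=> eqF; have tE a g : ext F (tau a g) = tau a (ext F g).
  by rewrite tau_ext -ext_tau; apply: eq_ext.
case: b; first by rewrite /dper raddfB /= tE.
by rewrite /dper /Nm raddf_sum; apply: eq_bigr => a _; rewrite /= tE.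
Qed.

End Extension.

(** * The periodic resolution inside the join *)

Section Resolution.

Variable n : nat.

(* [dper] preceded by the augmentation in degree 0. *)
Definition dpera N i (f : chain N) : chain N :=
  if i is 0 then f else dper (odd i) f.

(** Each apex has a fresh colour [j], above all those used so far, as the cone formula wants. The
    index counts vertices, so it is the dimension plus one. *)
Fixpoint res i : chain n.+1 :=
  if i is j.+1 then cone (inord j, 0) (dpera j (res j)) else delta void.

Definition initial i (y : simplex n.+1) :=
  [forall j : 'I_n.+1, (y j != None) ==> (j < i)%N].

Lemma initial_shift a i y : initial i (shift a y) = initial i y.
Proof. by apply: eq_forallb => j; rewrite shift_eqNone. Qed.

Lemma supported_dper N b (P : pred (simplex N)) f :
  (forall a y, P (shift a y) = P y) -> supported P f -> supported P (dper b f).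
Proof.
move=> inv Pf y; case: b; rewrite /dper.
  rewrite 3!ffunE => nz; case: (eqVneq (f y) 0) => [E|/Pf//].
  by move: nz; rewrite E subr0 => /Pf; rewrite inv.
rewrite NmE => nz.
have [a na|H] := pickP (fun a => f (shift (- a) y) != 0).
  by rewrite -(inv (- a)); apply: Pf.
by rewrite big1 ?eqxx // in nz => a _; have /negbFE/eqP := H a.
Qed.

Lemma supported_dpera N i (P : pred (simplex N)) f :
  (forall a y, P (shift a y) = P y) -> supported P f -> supported P (dpera i f).
Proof. by case: i => // i; apply: supported_dper. Qed.

Lemma supported_res i : (i <= n.+1)%N -> supported (initial i) (res i).
Proof.
elim: i => [_ y|i IH lt_in y].
  rewrite ffunE; case: (eqVneq void y) => [<- _|_]; last by rewrite eqxx.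
  by apply/forallP => j; rewrite ffunE.
rewrite coneE; case: ifP => [|_]; last by rewrite eqxx.
have S := supported_dpera (i := i) (@initial_shift^~ i) (IH (ltnW lt_in)).
move=> _ /S/forallP H; apply/forallP => j; have := H j.
rewrite ffunE; case: (eqVneq j (inord i)) => [-> _|_]; last first.
  by case: (y j) => //= g; apply: ltnW.
by rewrite inordK // ltnSn implybT.
Qed.

(** The error term of the cone formula is a composite of two consecutive periodic differentials, or,
    at the bottom, [tau 1 - 1] on the invariant [void]. *)
Lemma bd_res i : (i <= n)%N -> bd (res i.+1) = dpera i (res i).
Proof.
elim: i => [|i IH] lt_in.
  rewrite [res 1]/= bd_cone; last first.
    move=> y; rewrite ffunE; case: (eqVneq void y) => [<- _|_]; last by rewrite eqxx.
    by apply/forallP => j; rewrite ffunE.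
  by rewrite bd_void raddf0 subr0.
rewrite [res i.+2]/= -/(res i.+1) bd_cone; last first.
  have := supported_dpera (i := i.+1) (@initial_shift^~ i.+1)
    (supported_res (ltnW lt_in : i.+1 <= n.+1)%N).
  move=> S y /S /forallP H; apply/forallP => j; have := H j.
  by case: (y j != None) => //= lt; rewrite inordK // lt.
suff -> : bd (dpera i.+1 (res i.+1)) = 0 by rewrite raddf0 subr0.
rewrite /dpera bd_dper IH ?(ltnW lt_in) //; case: i {IH lt_in} => [|i].
  by rewrite /dpera /= tau_delta shift_void subrr.
by rewrite /dpera -[odd i.+1]negbK; apply: dper_dper.
Qed.

End Resolution.

(** The boundary never reads the value at [void], the one place that [dper_exact] leaves out. *)
Lemma eq_bd N (f g : chain N) : (forall y, y != void -> f y = g y) -> bd f = bd g.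
Proof.
move=> E; apply/ffunP => y; rewrite !ffunE; apply: eq_bigr => e _.
by rewrite E //; apply/negP => /voidP/(_ e.1); rewrite ffunE eqxx.
Qed.

Lemma nb_vertices_del N j (y : simplex N) : y j != None ->
  nb_vertices y = (nb_vertices (del_colour j y)).+1.
Proof.
move=> yj; rewrite /nb_vertices (cardsD1 j) inE yj; congr _.+1.
by apply: eq_card => i; rewrite !inE ffunE; case: eqP.
Qed.

(** * A Tucker-type theorem for the cyclic group *)

Section Tucker.

Variables n N : nat.
Variables (r : simplex n.+1 -> 'I_N) (s : simplex n.+1 -> G).
Hypothesis r_shift : forall a x, x != void -> r (shift a x) = r x.
Hypothesis s_shift : forall a x, x != void -> s (shift a x) = s x + a.
Hypothesis r_face : forall x y, x != void -> face x y -> (r x <= r y)%N.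
Hypothesis s_face : forall x y, x != void -> face x y -> r x = r y -> s x = s y.

(* The barycentric subdivision of [x], a cone over the subdivided boundary,
   followed by the simplicial map induced by the labelling [(r, s)]. *)
Fixpoint subdiv k x : chain N :=
  if k is l.+1 then cone (r x, s x) (ext (subdiv l) (bd (delta x))) else delta void.

(** The vertex count makes the chain vanish when [k > N]; the labels by faces keep the support below
    the next apex. *)
Definition labelled k x (y : simplex N) :=
  (nb_vertices y == k) &&
  [forall i, (y i != None) ==>
     [exists w, [&& w != void, face w x, r w == i & y i == Some (s w)]]].

Lemma supported_subdiv k x : supported (labelled k x) (subdiv k x).
Proof.
elim: k x => [|k IH] x y.
  rewrite ffunE; case: (eqVneq void y) => [<- _|_]; last by rewrite eqxx.
  apply/andP; split; last by apply/forallP => i; rewrite ffunE.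
  by rewrite /nb_vertices cards_eq0; apply/eqP/setP => i; rewrite !inE ffunE.
rewrite coneE; case: ifP => [/eqP /= yr|_]; last by rewrite eqxx.
move=> /ext_neq0[z /bd_delta_neq0[zx nv] /IH /andP[/eqP dz /forallP H]].
apply/andP; split; first by rewrite (@nb_vertices_del _ (r x)) ?yr // dz.
apply/forallP => i; case: (eqVneq i (r x)) => [->|ne].
  rewrite yr /=; apply/existsP; exists x.
  by rewrite nv face_refl !eqxx.
have := H i; rewrite ffunE (negPf ne); case: (y i != None) => //=.
case/existsP => w /and4P[wv wz rw sw]; apply/existsP; exists w.
by rewrite wv (face_trans wz zx) rw sw.
Qed.

(** Faces of [x] have rank at most [r x], with the sign of [x] in case of equality, so the cone
    formula applies; its error term dies by induction and [bd_bd]. *)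
Lemma bd_subdiv k x : bd (subdiv k.+1 x) = ext (subdiv k) (bd (delta x)).
Proof.
elim: k x => [|k IH] x; rewrite [subdiv _.+1 x]/= -?/(subdiv k.+1) bd_cone.
- suff -> : bd (ext (subdiv 0) (bd (delta x))) = 0 by rewrite raddf0 subr0.
  rewrite bd_ext; apply/ffunP => y; rewrite !ffunE big1 // => z _.
  by rewrite bd_void [X in _ * X]ffunE mulr0.
- move=> y /ext_neq0[z _]; rewrite ffunE.
  case: (eqVneq void y) => [<- _|_]; last by rewrite eqxx.
  by apply/forallP => i; rewrite ffunE.
- suff -> : bd (ext (subdiv k.+1) (bd (delta x))) = 0 by rewrite raddf0 subr0.
  by rewrite bd_ext (eq_ext _ IH) -ext_bd bd_bd raddf0.
move=> y /ext_neq0[z /bd_delta_neq0[zx nv] /supported_subdiv /andP[_ /forallP H]].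
apply/forallP => i; have := H i; case: (y i != None) => //=.
case/existsP => w /and4P[wv wz /eqP rw /eqP sw].
have wx := face_trans wz zx; have := r_face wv wx.
rewrite leq_eqVlt => /orP[/eqP/val_inj e|lt]; last by rewrite -rw lt.
by rewrite sw (s_face wv wx e) -rw e !eqxx orbT.
Qed.

Lemma tau_subdiv k a x : tau a (subdiv k x) = subdiv k (shift a x).
Proof.
elim: k x => [|k IH] x; first by rewrite tau_delta shift_void.
rewrite /= tau_cone tau_ext (eq_ext (F' := fun z => subdiv k (shift a z))) //.
(* The labels are equivariant only off [void], but [void] has zero boundary, so both cones vanish
   there. *)
rewrite ext_tau tau_bd tau_delta; case: (eqVneq x void) => [->|nv].
  by rewrite shift_void bd_void !raddf0.
by rewrite r_shift // s_shift.
Qed.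

(* If [n.+1 > N] the image of the resolution dies in degree [n.+1]. Descending
   with the exactness of the periodic differentials, the augmentation of its
   degree-zero part, which is 1, becomes a multiple of the group order. *)
Theorem cyclic_tucker : (n.+1 <= N)%N.
Proof.
rewrite leqNgt; apply/negP => ltN.
pose H i := ext (subdiv i) (res n i).
have bdH i : (i <= n)%N -> bd (H i.+1) = dpera i (H i).
  move=> le; rewrite /H bd_ext (eq_ext _ (bd_subdiv i)) -ext_bd bd_res //.
  by case: i {le} => // i; rewrite /dpera ext_dper // => a x; apply: tau_subdiv.
have Htop : H n.+1 = 0.
  apply/ffunP => y; rewrite [RHS]ffunE; apply/eqP; apply/negP => /negP.
  move=> /ext_neq0[x _ /supported_subdiv /andP[/eqP dy _]].
  move: ltN; rewrite -dy ltnNge /nb_vertices => /negP; apply.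
  by rewrite -[X in (_ <= X)%N]card_ord max_card.
(* Descending induction on the degree [n.+1 - j], whose parity selects the differential. *)
have desc j : (j <= n)%N -> exists g, bd (H (n.+1 - j)%N) = dper (~~ odd (n.+1 - j)) (bd g).
  elim: j => [_|j IH lt_jn]; first by exists 0; rewrite subn0 Htop !raddf0.
  have [g] := IH (ltnW lt_jn); set i := (n.+1 - j.+1)%N.
  have -> : (n.+1 - j = i.+1)%N by rewrite /i; lia.
  rewrite bdH; last by rewrite /i; lia.
  have i_gt0 : (0 < i)%N by rewrite /i; lia.
  rewrite /dpera -{1}(prednK i_gt0) /= negbK => E.
  have /dper_exact[g' E'] : dper (odd i) (H i - bd g) = 0 by rewrite raddfB /= E subrr.
  exists g'; rewrite -bd_dper (@eq_bd _ (H i) (bd g + dper (~~ odd i) g')).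
    by rewrite raddfD /= bd_bd add0r.
  have addE (u v : chain N) y : (u + v) y = u y + v y by rewrite ffunE.
  by move=> y nv; rewrite addE -E' // -addE addrC subrK.
(* In degree 1 this says that [delta void] is a norm; at [void], fixed by all shifts, 1 would be a
   multiple of [q.+2]. *)
have [g] := desc n (leqnn n); rewrite subSnn bdH // /dpera /H ext_delta /=.
move/ffunP/(_ void); rewrite ffunE eqxx NmE.
rewrite (eq_bigr (fun=> bd g void)) => [|a _]; last by rewrite shift_void.
rewrite sumr_const card_ord -[_ *+ q.+2]mulr_natr => /(congr1 absz).
by rewrite abszM [q.+2%:R]natz /= => /esym/eqP; rewrite muln_eq1 andbF.
Qed.

End Tucker.

End Chains.
Arguments void {q N}.

(** * Colourings of loopless graphs *)

Lemma chromatic_number_colorable (V : finType) (e : rel V) :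
  irreflexive e -> colorable e (chromatic_number e).
Proof.
move=> irr.
have hasc : has (colorable e) (iota 0 #|V|.+1).
  apply/hasP; exists #|V|; first by rewrite mem_iota add0n leqnn.
  apply/existsP; exists [ffun x => enum_rank x]; apply/forallP => x.
  apply/forallP => y; apply/implyP => exy; rewrite !ffunE.
  by apply: contraTneq exy => /enum_rank_inj ->; rewrite irr.
have := nth_find 0%N hasc; rewrite nth_iota ?add0n //.
by rewrite -[X in (_ < X)%N](size_iota 0) -has_find.
Qed.

Lemma kn_adj_irr n k m : (0 < k)%N -> irreflexive (@kn_adj n k m.+1).
Proof.
move=> k_gt0 X; rewrite /kn_adj orbb; apply/negbTE/negP => /forallP/(_ ord0).
have /andP[/forallP/(_ ord0)/eqP cX _] := valP X.
have /card_gt0P[i Xi] : (0 < #|val X ord0|)%N by rewrite cX.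
by move/eqP/setP/(_ i); rewrite !inE => /negP[]; apply/andP; split; apply/bigcupP; exists ord0.
Qed.

(** * Rank and sign of a partial labelling *)

Section KneserLabels.

Variables q n k t : nat.
Local Notation G := 'I_q.+2.
Local Notation simplex := {ffun 'I_n -> option G}.
Variable col : KNvertex n k q.+1 -> 'I_t.
Implicit Types (x y : simplex) (g : G).

Definition cls x g : {set 'I_n} := [set i | x i == Some g].

(** There is one block fewer than there are classes: rotation [g] uses every class except
    [g - 1]. *)
Definition cols x g : {set 'I_t} :=
  [set c | [exists A : KNvertex n k q.+1, (col A == c) &&
     [forall l : 'I_q.+1, val A l \subset cls x (g + (l : nat)%:R)]]].

Definition profile x g : 'I_k.+1 * {set 'I_t} := (inord (minn #|cls x g| k), cols x g).

Definition rank x := \sum_g (minn #|cls x g| k + #|cols x g|)%N.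

Definition level x d : {set G} := [set g | profile x g == d].

(* A proper nonempty subset of the group has a barycentre because the group
   order is prime. *)
Definition sgn x : G :=
  if [pick d | (0 < #|level x d| < q.+2)%N] is Some d
  then (\sum_(g in level x d) g) / #|level x d|%:R else lead x.

Lemma cls_shift a x g : cls (shift a x) g = cls x (g - a).
Proof. by apply/setP => i; rewrite !inE shift_eqSome. Qed.

Lemma cols_shift a x g : cols (shift a x) g = cols x (g - a).
Proof.
apply/setP => c; rewrite !inE; apply: eq_existsb => A; congr (_ && _).
by apply: eq_forallb => l; rewrite cls_shift addrAC.
Qed.

Lemma profile_shift a x g : profile (shift a x) g = profile x (g - a).
Proof. by rewrite /profile cls_shift cols_shift. Qed.

Lemma rank_shift a x : rank (shift a x) = rank x.
Proof.
rewrite /rank (reindex_inj (addIr a)); apply: eq_bigr => g _.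
by rewrite cls_shift cols_shift addrK.
Qed.

Lemma level_shift a x d : level (shift a x) d = [set g + a | g in level x d].
Proof.
apply/setP => g; rewrite inE profile_shift; apply/idP/imsetP => [H|[h]].
  by exists (g - a); rewrite ?subrK ?inE.
by rewrite inE => H ->; rewrite addrK.
Qed.

(** Translating a level set by [a] adds its size times [a] to its sum, and that size is invertible
    modulo the prime. *)
Lemma sgn_shift a x : prime q.+2 -> x != void -> sgn (shift a x) = sgn x + a.
Proof.
move=> pr nv; rewrite /sgn.
have cE d : #|level (shift a x) d| = #|level x d|.
  by rewrite level_shift card_imset //; apply: addIr.
rewrite (eq_pick (Q := fun d => (0 < #|level x d| < q.+2)%N)) => [|d]; last by rewrite cE.
case: pickP => [d /andP[W0 W1]|_]; last exact: lead_shift.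
have u : (#|level x d|%:R : G) \is a GRing.unit.
  by rewrite (@unitZpE q.+2) // prime_coprime // gtnNdvd.
apply: (mulIr u); rewrite mulrDl cE !divrK // level_shift big_imset /=; last first.
  by move=> g h _ _; apply: addIr.
by rewrite big_split /= sumr_const mulr_natr.
Qed.

Lemma cls_face x y g : face x y -> cls x g \subset cls y g.
Proof.
by move=> /faceP xy; apply/subsetP => i; rewrite !inE => /eqP/xy ->.
Qed.

Lemma cols_face x y g : face x y -> cols x g \subset cols y g.
Proof.
move=> xy; apply/subsetP => c; rewrite !inE => /existsP[A /andP[cA /forallP H]].
apply/existsP; exists A; rewrite cA; apply/forallP => l.
by apply: subset_trans (H l) _; apply: cls_face.
Qed.

Lemma rank_face x y : face x y -> (rank x <= rank y)%N.
Proof.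
move=> xy; apply: leq_sum => g _; apply: leq_add.
  have := subset_leq_card (cls_face g xy); lia.
exact: subset_leq_card (cols_face g xy).
Qed.

(** Every summand of the rank is monotone, so equal totals force equal summands, and nested colour
    sets of equal size coincide. *)
Lemma profile_face x y : face x y -> rank x = rank y -> profile x =1 profile y.
Proof.
move=> xy.
have le1 g : (minn #|cls x g| k <= minn #|cls y g| k)%N.
  have := subset_leq_card (cls_face g xy); lia.
have le2 g := subset_leq_card (cols_face g xy).
have := leqif_sum (fun g (_ : true) => leqif_eq (leq_add (le1 g) (le2 g))).
case=> _; rewrite -/(rank x) -/(rank y) => E rxy g.
move: E; rewrite rxy eqxx => /esym/forallP/(_ g)/= /eqP E.
have [E1 E2] : minn #|cls x g| k = minn #|cls y g| k /\ #|cols x g| = #|cols y g|.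
  have add_leE a b c d : (a <= c -> b <= d -> a + b = c + d -> a = c /\ b = d)%N by lia.
  exact: add_leE (le1 g) (le2 g) E.
rewrite /profile E1; congr (_, _); apply/eqP.
by rewrite eqEcard cols_face //= E2.
Qed.

Lemma rank_le x : (rank x <= q.+2 * (k + t))%N.
Proof.
rewrite -[q.+2]card_ord -sum_nat_const; apply: leq_sum => g _.
by rewrite leq_add ?geq_minr // -[X in (_ <= X)%N]card_ord max_card.
Qed.

Lemma rank_gt0 x : (0 < k)%N -> x != void -> (0 < rank x)%N.
Proof.
move=> k_gt0 nv.
have [i xi|H] := pickP (fun i => x i != None); last first.
  by case/voidP: nv => i; have /negbFE/eqP := H i.
case xE: (x i) xi => [g|] // _.
rewrite /rank (bigD1 g) //=; do 2!apply: leq_trans (leq_addr _ _).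
by rewrite leq_min k_gt0 andbT; apply/card_gt0P; exists i; rewrite inE xE.
Qed.

Lemma natr_ord_val (l : nat) : (l < q.+2)%N -> val (l%:R : G) = l.
Proof. by move=> lt; rewrite Zp_nat /= modn_small. Qed.

Hypothesis colP : forall X Y, kn_adj X Y -> col X != col Y.

(* Equal colours in two consecutive rotations would give adjacent vertices of
   the same colour. *)
Lemma profile_const_small x : (forall g h, profile x g = profile x h) ->
  forall g, (#|cls x g| < k)%N.
Proof.
move=> cst.
have minE g h : minn #|cls x g| k = minn #|cls x h| k.
  have /(congr1 (fun d => val d.1)) := cst g h.
  by rewrite /= !inordK // ltnS geq_minr.
move=> g0; rewrite ltnNge; apply/negP => big0.
have big g : (k <= #|cls x g|)%N by have := minE g g0; lia.
(* A vertex seen at rotation 0: [k] points from each class but the last. *)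
pose A : {ffun 'I_q.+1 -> {set 'I_n}} :=
  [ffun l => [set:: take k (enum (cls x (nat_of_ord l)%:R))]].
have subA l : A l \subset cls x (nat_of_ord l)%:R.
  by apply/subsetP => i; rewrite ffunE inE => /mem_take; rewrite mem_enum.
have predA : kn_vertex_pred k A.
  apply/andP; split.
    apply/forallP => l; rewrite ffunE cardsE.
    rewrite (card_uniqP _) ?take_uniq ?enum_uniq //.
    by rewrite size_takel // -cardE.
  apply/forallP => l1; apply/forallP => l2; apply/implyP => ne.
  rewrite -setI_eq0; apply/eqP/setP => i; rewrite !inE; apply/negP.
  case/andP => /(subsetP (subA l1)); rewrite inE => /eqP x1.
  move/(subsetP (subA l2)); rewrite inE x1 => /eqP[/(congr1 val)].
  rewrite !natr_ord_val ?(ltn_trans (ltn_ord _)) // => /val_inj E.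
  by rewrite E eqxx in ne.
pose X : KNvertex n k q.+1 := Sub A predA.
have : col X \in cols x 0.
  rewrite inE; apply/existsP; exists X; rewrite eqxx; apply/forallP => l.
  by rewrite add0r SubK.
rewrite (congr1 snd (cst 0 1) : cols x 0 = cols x 1) inE.
case/existsP => Y /andP[/eqP cY /forallP subY].
have /colP : kn_adj X Y; last by rewrite cY eqxx.
apply/orP; left; apply/forallP => i; apply/eqP/setP => j; rewrite !inE; apply/negP.
(* A common point would lie in class [a] with [a <= i] and in class [b + 1] with [b >= i]; as
   [b + 1 <= q.+1], nothing wraps around. *)
case/andP => /bigcupP[a le_ai]; rewrite SubK => /(subsetP (subA a)); rewrite inE => /eqP xa.
case/bigcupP => b le_ib /(subsetP (subY b)); rewrite inE xa nat1r => /eqP[/(congr1 val)].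
rewrite (natr_ord_val (leqW (ltn_ord a))) natr_ord_val; last by rewrite ltnS ltn_ord.
by move=> E; have := leq_trans le_ai le_ib; rewrite E ltnn.
Qed.

Lemma sgn_face x y : x != void -> face x y -> rank x = rank y -> sgn x = sgn y.
Proof.
move=> nv xy rxy; have pE := profile_face xy rxy.
have lE d : level x d = level y d by apply/setP => g; rewrite !inE pE.
rewrite /sgn (eq_pick (Q := fun d => (0 < #|level y d| < q.+2)%N)) => [|d]; last by rewrite lE.
case: pickP => [d _|none]; first by rewrite lE.
have cst g : profile x g = profile x 0.
  have := none (profile x 0); rewrite -lE => /negbT; rewrite negb_and -leqNgt.
  rewrite leqn0 cards_eq0 -[X in _ || X]leqNgt => /orP[/eqP/setP/(_ 0)|full].
    by rewrite !inE eqxx.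
  have /setP/(_ g) : level x (profile x 0) = setT.
    by apply/eqP; rewrite eqEcard subsetT cardsT card_ord.
  by rewrite !inE => /eqP.
(* All classes stay below the cap [k], so equal profiles give equal class sizes, and the face [x]
   must be all of [y]. *)
have small := profile_const_small (fun g h => etrans (cst g) (esym (cst h))).
suff -> : x = y by [].
have clsE g : cls x g = cls y g.
  apply/eqP; rewrite eqEcard cls_face //=.
  have /(congr1 (fun d => val d.1)) := pE g.
  rewrite /= !inordK ?ltnS ?geq_minr // => E.
  have minn_le a b : (a < k -> minn a k = minn b k -> b <= a)%N by lia.
  exact: minn_le (small g) E.
apply/ffunP => i; move: xy => /faceP xy.
case xi: (x i) => [g|]; first by rewrite (xy _ _ xi).
case yi: (y i) => [g|] //.
by have /setP/(_ i) := clsE g; rewrite !inE xi yi eqxx.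
Qed.

End KneserLabels.

(** * The bound on the number of colours *)

Lemma kneser_colour_bound q n k t (col : KNvertex n.+1 k q.+1 -> 'I_t) :
  prime q.+2 -> (0 < k)%N -> (forall X Y, kn_adj X Y -> col X != col Y) ->
  (n.+1 <= q.+2 * (k + t))%N.
Proof.
move=> pr k_gt0 colP.
have [N EN] : exists N, (q.+2 * (k + t) = N.+1)%N.
  by exists (q.+2 * (k + t)).-1; rewrite prednK // muln_gt0 addn_gt0 k_gt0.
(* Nonempty labellings have rank from 1 to [N.+1], hence the predecessor. *)
pose r (x : {ffun 'I_n.+1 -> option 'I_q.+2}) : 'I_N.+1 := inord (rank col x).-1.
have rE x : r x = (rank col x).-1 :> nat.
  by rewrite inordK //; have := rank_le col x; rewrite EN; lia.
rewrite EN; apply: (@cyclic_tucker q n N.+1 r (sgn col)).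
- by move=> a x _; rewrite /r rank_shift.
- by move=> a x; apply: sgn_shift.
- by move=> x y _ xy; rewrite !rE; have := rank_face col xy; lia.
move=> x y nv xy /(congr1 val) /=; rewrite !rE => E.
apply: sgn_face => //; have := rank_gt0 col k_gt0 nv.
by have := rank_face col xy; lia.
Qed.

Theorem theorem4p2 (n m k : nat) :
  (2 <= n)%N -> (2 <= m)%N -> (2 <= k)%N ->
  ((m.+1 * k) <= n)%N -> prime m.+1 ->
  ((n%:R / (m.+1)%:R - k%:R) / ((m.+1)%:R * ((m.+1)%:R - 1)) : rat)
    <= (chromatic_number (@kn_adj n k m))%:R.
Proof.
case: n => // n; case: m => // q _ _ k_gt1 _ pr.
have k_gt0 := ltnW k_gt1.
set t := chromatic_number _.
have /existsP[f /forallP fP] : colorable (@kn_adj n.+1 k q.+1) t.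
  exact/chromatic_number_colorable/kn_adj_irr.
have bound : (n.+1 <= q.+2 * (k + t))%N.
  apply: (@kneser_colour_bound q n k t f) => // X Y adj.
  by have /forallP/(_ Y)/implyP/(_ adj) := fP X.
have p_gt0 : 0 < q.+2%:R :> rat by rewrite ltr0n.
have p1 : q.+2%:R - 1 = q.+1%:R :> rat by rewrite -natr1 addrK.
rewrite p1 ler_pdivrMr ?mulr_gt0 ?ltr0n //.
have : n.+1%:R / q.+2%:R - k%:R <= t%:R :> rat.
  by rewrite lerBlDl ler_pdivrMr // -natrD -natrM ler_nat mulnC.
(* As [t >= 0] and [p (p - 1) >= 1], multiplying [t] by [p (p - 1)] keeps the bound. *)
move=> /le_trans -> //; rewrite -natrM ler_peMr ?ler0n //.
by rewrite ler1n muln_gt0.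
Qed.
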